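(* Let $\Phi_A:X\to S(A)$ be lower semi-continuous, let $\Phi_B:\mathrm{Gr}(\Phi_A)\to S(B)$ be $A$-lower semi-continuous, let $f:\mathrm{Gr}(\Phi_B)\to\mathbb{R}$ (real-valued) be $\mathbb{K}$-sup-compact on $\mathrm{Gr}(\Phi_B)$, and let the function $f^{A\leftrightarrow B}:\mathrm{Gr}(\Phi_B^{A\leftrightarrow B})\to\mathbb{R}$ be $\mathbb{K}$-inf-compact on $\mathrm{Gr}(\Phi_B^{A\leftrightarrow B})$. Then the worst-loss function $f^\sharp:\mathrm{Gr}(\Phi_A)\to\mathbb{R}$ is (real-valued and) continuous and the minimax function $v^\sharp:X\to\mathbb{R}$ is (real-valued and) continuous. Moreover: (a) the infimum in $v^\sharp(x)=\inf_{a\in\Phi_A(x)}\sup_{b\in\Phi_B(x,a)}f(x,a,b)$ can be replaced with the minimum for every $x\in X$, and the solution multifunction $\Phi_A^*:X\to S(A)$ is upper semi-continuous and compact-valued; (b) the suprema in $f^\sharp(x,a)=\sup_{b\in\Phi_B(x,a)}f(x,a,b)$ and in the definition of $v^\sharp$ can be replaced with maxima, and the solution multifunction $\Phi_B^*:\mathrm{Gr}(\Phi_A)\to S(B)$ is upper semi-continuous and compact-valued.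
   Context: $X,A,B$ are metric spaces; $S(E)$ denotes the family of nonempty subsets of $E$. $\Phi_A:X\to S(A)$ is a set-valued mapping with graph $\mathrm{Gr}(\Phi_A)=\{(x,a)\in X\times A: a\in\Phi_A(x)\}$, and $\Phi_B:\mathrm{Gr}(\Phi_A)\to S(B)$ is a set-valued mapping with graph $\mathrm{Gr}(\Phi_B)=\{(x,a,b):(x,a)\in\mathrm{Gr}(\Phi_A),\ b\in\Phi_B(x,a)\}$. Definitions: worst-loss function $f^\sharp(x,a)=\sup_{b\in\Phi_B(x,a)}f(x,a,b)$ for $(x,a)\in\mathrm{Gr}(\Phi_A)$; minimax function $v^\sharp(x)=\inf_{a\in\Phi_A(x)}f^\sharp(x,a)$ for $x\in X$; solution multifunctions $\Phi_A^*(x)=\{a\in\Phi_A(x):v^\sharp(x)=f^\sharp(x,a)\}$ and $\Phi_B^*(x,a)=\{b\in\Phi_B(x,a):f^\sharp(x,a)=f(x,a,b)\}$. Swapped data: $\Phi_B^{A\leftrightarrow B}:X\times B\to 2^A$, $\Phi_B^{A\leftrightarrow B}(x,b)=\{a\in\Phi_A(x): b\in\Phi_B(x,a)\}$, with graph $\{(x,b,a):(x,a,b)\in\mathrm{Gr}(\Phi_B)\}$, and $f^{A\leftrightarrow B}(x,b,a)=f(x,a,b)$. $\mathbb{K}$-inf-compactness: for metric spaces $U,V$, a set-valued mapping $\Psi:U\to 2^V$ with $\mathrm{Dom}\,\Psi=\{u:\Psi(u)\neq\emptyset\}\ne\emptyset$, and $g:\mathrm{Gr}(\Psi)\to\mathbb{R}\cup\{\pm\infty\}$,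 $g$ is $\mathbb{K}$-inf-compact on $\mathrm{Gr}(\Psi)$ if for every nonempty compact $C\subset\mathrm{Dom}\,\Psi$ and every $\lambda\in\mathbb{R}$ the set $\{(u,y):u\in C,\ y\in\Psi(u),\ g(u,y)\le\lambda\}$ is compact; $g$ is $\mathbb{K}$-sup-compact if $-g$ is $\mathbb{K}$-inf-compact. For $f$ on $\mathrm{Gr}(\Phi_B)$ the first variable is $u=(x,a)$ with domain $\mathrm{Gr}(\Phi_A)$; for $f^{A\leftrightarrow B}$ it is $u=(x,b)$ with domain $\mathrm{Dom}\,\Phi_B^{A\leftrightarrow B}$. Lower/upper semi-continuity of set-valued mappings is the usual (Berge, neighborhood) notion relative to the domain on which the mapping is defined. $\Phi_B$ is called $A$-lower semi-continuous if: whenever $x^{(n)}\to x$ in $X$, $a^{(n)}\in\Phi_A(x^{(n)})$ for all $n$, and $b\in\Phi_B(x,a)$ for some $a\in\Phi_A(x)$, there is a sequence $b^{(n)}\in\Phi_B(x^{(n)},a^{(n)})$, $n=1,2,\dots$, such that $b$ is a limit point (limit of a subsequence) of $\{b^{(n)}\}$. *)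

(* Defs.v *)
(* MathComp-Analysis. *)
From mathcomp Require Import all_boot all_order all_algebra.
From mathcomp Require Import all_classical all_reals all_analysis.

Set Implicit Arguments.
Unset Strict Implicit.
Unset Printing Implicit Defensive.

Import Order.TTheory GRing.Theory Num.Theory.
Import numFieldNormedType.Exports.

Local Open Scope classical_set_scope.
Local Open Scope ring_scope.

(* A set-valued mapping Psi : U -> 2^V is a function [U -> set V].  A mapping
   D -> S(V) with nonempty values, defined only on a subset D of U, is encoded
   by the Psi with [mdom Psi = D], i.e. extended by the empty set outside D. *)
Definition mdom (U V : Type) (Psi : U -> set V) : set U :=
  [set u | Psi u !=set0].

Definition mgraph (U V : Type) (Psi : U -> set V) : set (U * V) :=
  [set p | Psi p.1 p.2].

(* Berge semi-continuity, relative to the domain of the mapping. *)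
Definition lower_semicont (U V : topologicalType) (Psi : U -> set V) : Prop :=
  forall u, mdom Psi u -> forall G : set V, open G -> Psi u `&` G !=set0 ->
    \forall u' \near within (mdom Psi) (nbhs u), Psi u' `&` G !=set0.

Definition upper_semicont (U V : topologicalType) (Psi : U -> set V) : Prop :=
  forall u, mdom Psi u -> forall G : set V, open G -> Psi u `<=` G ->
    \forall u' \near within (mdom Psi) (nbhs u), Psi u' `<=` G.

(* Only the values of g on [mgraph Psi] matter. *)
Definition K_inf_compact (R : realType) (U V : topologicalType)
    (Psi : U -> set V) (g : U * V -> \bar R) : Prop :=
  mdom Psi !=set0 /\
  forall C : set U, C !=set0 -> compact C -> C `<=` mdom Psi ->
  forall l : R,
    compact [set p : U * V | [/\ C p.1, Psi p.1 p.2 & (g p <= l%:E)%E]].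

Definition K_sup_compact (R : realType) (U V : topologicalType)
    (Psi : U -> set V) (g : U * V -> \bar R) : Prop :=
  K_inf_compact Psi (fun p => (- g p)%E).

(* Convergence of a_ is not required, and the a with b in PhiB (x, a) is
   unrelated to a_. *)
Definition A_lower_semicont (X A B : topologicalType)
    (PhiA : X -> set A) (PhiB : X * A -> set B) : Prop :=
  forall (x_ : nat -> X) (x : X) (a_ : nat -> A) (b : B),
    x_ @ \oo --> x ->
    (forall n, PhiA (x_ n) (a_ n)) ->
    (exists2 a, PhiA x a & PhiB (x, a) b) ->
    exists2 b_ : nat -> B,
      forall n, PhiB (x_ n, a_ n) (b_ n) &
      exists2 phi : nat -> nat,
        {homo phi : m n / (m < n)%N} & (b_ \o phi) @ \oo --> b.

Definition is_min (R : realType) (S : set (\bar R)) (m : \bar R) : Prop :=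
  S m /\ lbound S m.

Definition is_max (R : realType) (S : set (\bar R)) (m : \bar R) : Prop :=
  S m /\ ubound S m.

Definition swap_map (X A B : Type) (PhiA : X -> set A) (PhiB : X * A -> set B) :
    X * B -> set A :=
  fun q => [set a | PhiA q.1 a /\ PhiB (q.1, a) q.2].

Definition swap_fun (X A B T : Type) (f : X * A * B -> T) : X * B * A -> T :=
  fun q => f (q.1.1, q.2, q.1.2).

Definition worst_loss (R : realType) (X A B : Type) (PhiB : X * A -> set B)
    (f : X * A * B -> R) (p : X * A) : \bar R :=
  ereal_sup [set (f (p, b))%:E | b in PhiB p].

Definition minimax (R : realType) (X A B : Type) (PhiA : X -> set A)
    (PhiB : X * A -> set B) (f : X * A * B -> R) (x : X) : \bar R :=
  ereal_inf [set worst_loss PhiB f (x, a) | a in PhiA x].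

Definition solA (R : realType) (X A B : Type) (PhiA : X -> set A)
    (PhiB : X * A -> set B) (f : X * A * B -> R) (x : X) : set A :=
  [set a | PhiA x a /\ minimax PhiA PhiB f x = worst_loss PhiB f (x, a)].

Definition solB (R : realType) (X A B : Type) (PhiB : X * A -> set B)
    (f : X * A * B -> R) (p : X * A) : set B :=
  [set b | PhiB p b /\ worst_loss PhiB f p = (f (p, b))%:E].

(* Main.v *)
(* K-inf-compactness gives, for u_n -> u in the domain and y_n in Psi u_n with
   g (u_n, y_n) <= l_n -> l, a cluster point of y_n in the sublevel set l of
   g (u, .).  Applied to - f this makes the worst loss upper semi-continuous.
   Applied to the swapped f along a sequence b_n -> b provided by A-lower
   semi-continuity, it makes the worst loss lower semi-continuous and also gives
   cluster points of any sequence a_n in Phi_A (x_n) with bounded worst loss,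
   which yields the minimizers, the lower semi-continuity of the minimax
   function and the upper semi-continuity of its solution map.  Upper
   semi-continuity of the minimax function comes from the lower
   semi-continuity of Phi_A and the upper semi-continuity of the worst loss. *)
Require Import Defs.
From mathcomp Require Import all_boot all_order all_algebra.
From mathcomp Require Import all_classical all_reals all_analysis.

Set Implicit Arguments.
Unset Strict Implicit.
Unset Printing Implicit Defensive.

Import Order.TTheory GRing.Theory Num.Theory.
Import numFieldNormedType.Exports.

Local Open Scope classical_set_scope.
Local Open Scope ring_scope.

(** * Topological preliminaries: cluster points and convergent sequences *)

Lemma hausdorff_prod (U V : topologicalType) :
  hausdorff_space U -> hausdorff_space V -> hausdorff_space (U * V)%type.
Proof.
move=> hU hV [p1 p2] [q1 q2] clpq; congr (_, _).
- apply: hU => P Q p1P q1Q.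
  have [| |[x y] [/= Px Qx]] := clpq (fst @^-1` P) (fst @^-1` Q).
  + exact: (cvg_fst (F := nbhs p1) (G := nbhs p2)).
  + exact: (cvg_fst (F := nbhs q1) (G := nbhs q2)).
  + by exists x.
- apply: hV => P Q p2P q2Q.
  have [| |[x y] [/= Py Qy]] := clpq (snd @^-1` P) (snd @^-1` Q).
  + exact: (cvg_snd (F := nbhs p1) (G := nbhs p2)).
  + exact: (cvg_snd (F := nbhs q1) (G := nbhs q2)).
  + by exists y.
Qed.

Lemma cvg_cluster_unique (T : topologicalType) (F : set_system T) (p q : T) :
  hausdorff_space T -> F --> p -> cluster F q -> p = q.
Proof. by move=> hT Fp Fq; apply: hT; exact: cvg_cluster Fp _ Fq. Qed.

Lemma cvg_subseq_index (phi : nat -> nat) :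
  {homo phi : m n / (m < n)%N} -> phi @ \oo --> \oo.
Proof.
move=> phiS P [N _ NP]; exists N => // n Nn; apply: NP => /=.
apply: leq_trans Nn _; elim: n => // n IH.
by rewrite (leq_ltn_trans IH)// phiS.
Qed.

(** In the near-covering form of compactness, a neighbourhood of [x] absorbs a tail of the sequence,
    and the finitely many remaining terms are handled by induction. It supplies the compact set [C]
    on which K-inf-compactness is tested along a sequence. *)
Lemma compact_cvg_range (T : topologicalType) (u : nat -> T) (x : T) :
  u @ \oo --> x -> compact (x |` range u).
Proof.
move=> ux; apply/compact_near_coveringP => I F P FF cov.
have [[U J] /= [xU FJ] UJ] := cov x (or_introl erefl).
have [N _ uU] := ux _ xU.
have fin : \forall i \near F, forall n, (n < N)%N -> P i (u n).
  elim: N {uU} => [|N IH]; first by near=> i.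
  have [[V K] /= [uV FK] VK] := cov (u N) (or_intror (imageT u N)).
  near=> i => n; rewrite ltnS leq_eqVlt => /predU1P[->|].
    by apply: (VK (u N, i)); split=> /=; [exact: nbhs_singleton|near: i].
  by move: n; near: i.
near=> i => _ [->|[n _ <-]].
  by apply: (UJ (x, i)); split=> /=; [exact: nbhs_singleton|near: i].
have [nN|Nn] := ltnP n N; first by move: n nN; near: i.
by apply: (UJ (u n, i)); split=> /=; [exact: uU|near: i].
Unshelve. all: by end_near. Qed.

(** If the conclusion fails, a point of [D] violating [P] can be chosen in each ball of radius
    1/(n+1); these points converge to [p]. *)
Lemma near_within_seq (R : realType) (T : pseudoMetricType R) (D P : set T)
    (p : T) :
  (forall u : nat -> T, (forall n, D (u n)) -> u @ \oo --> p ->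
     exists n, P (u n)) ->
  \forall q \near within D (nbhs p), P q.
Proof.
move=> seqP; apply: contrapT => nP.
have /choice[u uP] : forall n : nat,
    exists q, [/\ ball p n.+1%:R^-1 q, D q & ~ P q].
  move=> n; apply: contrapT => nq; apply: nP.
  have n0 : (0 : R) < n.+1%:R^-1 by rewrite invr_gt0.
  apply: filterS (nbhsx_ballx p _ n0) => q pq Dq.
  by apply: contrapT => nPq; apply: nq; exists q.
have [n] : exists n, P (u n).
  apply: seqP => [n|]; first by have [] := uP n.
  apply/cvg_ballP => e e0; near=> n.
  have [pu _ _] := uP n; apply: le_ball pu; apply: ltW.
  by near: n; exact: near_infty_natSinv_lt (PosNum e0).
by have [] := uP n.
Unshelve. all: by end_near. Qed.

(** * Consequences of K-inf-compactness, and attainment of minima *)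

Section K_inf_compact.
Context (R : realType) (U V : topologicalType) (Psi : U -> set V).
Context (g : U * V -> R).
Hypothesis hU : hausdorff_space U.
Hypothesis hV : hausdorff_space V.
Hypothesis Kg : K_inf_compact Psi (fun p => (g p)%:E).

Lemma K_inf_slice (u : U) (l : R) : compact [set y | Psi u y /\ g (u, y) <= l].
Proof.
(* K-inf-compactness only concerns compact subsets of the domain, so an empty value is treated
   apart; otherwise the slice is a projection of the set over [[set u]]. *)
have [[y0 Py0]|nPu] := pselect (mdom Psi u); last first.
  rewrite (_ : [set y | _] = set0); first exact: compact0.
  by apply/seteqP; split=> // y [Py _]; apply: nPu; exists y.
have sub : [set u] `<=` mdom Psi by move=> _ ->; exists y0.
have cK := Kg.2 _ (ex_intro _ u erefl) (@compact_set1 _ u) sub l.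
rewrite (_ : [set y | _] = snd @` [set p : U * V |
    [/\ [set u] p.1, Psi p.1 p.2 & ((g p)%:E <= l%:E)%E]]).
  apply: continuous_compact cK; apply: continuous_subspaceT.
  by move=> [a b]; exact: cvg_snd.
apply/seteqP; split=> [y [Py gy]|y [[u' y'] /= [-> Py]]].
  by exists (u, y) => //=; split=> //; rewrite lee_fin.
by rewrite lee_fin => gy <-.
Qed.

Lemma K_inf_seq (u : nat -> U) (u0 : U) (y : nat -> V) (l_ : nat -> R) (l : R) :
  u @ \oo --> u0 -> mdom Psi u0 -> (forall n, Psi (u n) (y n)) ->
  l_ @ \oo --> l -> (forall n, g (u n, y n) <= l_ n) ->
  exists y0, [/\ Psi u0 y0, g (u0, y0) <= l &
    cluster ((fun n => (u n, y n)) @ \oo) (u0, y0)].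
Proof.
move=> uu0 Pu0 Py ll gl.
pose C := u0 |` range u.
(* The bounds [l_ n] may exceed [l], but the sequence is eventually in [K e] for each [e > 0].
   Compactness of [K 1] gives a cluster point, and closedness of every [K e] then brings the bound
   down to [l]. *)
pose K (e : R) := [set p : U * V |
  [/\ C p.1, Psi p.1 p.2 & ((g p)%:E <= (l + e)%:E)%E]].
have cK e : compact (K e).
  apply: (Kg.2 C); first by exists u0; left.
    exact: compact_cvg_range.
  by move=> _ [->//|[n _ <-]]; exists (y n).
have evK e : 0 < e -> ((fun n => (u n, y n)) @ \oo) (K e).
  move=> e0; have : \forall n \near \oo, l_ n < l + e.
    by apply: cvgr_lt ll _ _; rewrite ltrDl.
  apply: filterS => n ln; split => //=; first by right; exists n.
  by rewrite lee_fin (le_trans (gl n))// ltW.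
have [[u1 y0] [K1 cl]] := cK 1 _ (fmap_proper_filter _ _) (evK 1 ltr01).
(* The first coordinates converge to [u0], so in a Hausdorff space no other point can be the first
   coordinate of a cluster point. *)
have u10 : u0 = u1.
  apply: hU => P Q u0P u1Q.
  have [] := cl (fst @^-1` P) (fst @^-1` Q).
  + by apply: uu0.
  + exact: (cvg_fst (F := nbhs u1) (G := nbhs y0)).
  by move=> [a b] [/= Pa Qa]; exists a.
subst u1.
exists y0; split => //; first by case: K1.
apply/ler_addgt0Pr => e e0.
suff [_ _] : K e (u0, y0) by rewrite lee_fin.
have := compact_closed (hausdorff_prod hU hV) (cK e); apply.
by move=> Q /cl; apply; exact: evK.
Qed.

End K_inf_compact.

Arguments K_inf_slice {R U V Psi g} Kg u l.

(** The sublevel sets at attained values are nested and nonempty, hence generate a proper filter;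
    being compact, thus closed, they all contain its cluster point, which is a minimizer. *)
Lemma ex_minimum (R : realType) (T : topologicalType) (S : set T) (h : T -> R) :
  hausdorff_space T -> S !=set0 ->
  (forall l, compact [set t | S t /\ h t <= l]) ->
  exists2 t, S t & forall s, S s -> h t <= h s.
Proof.
move=> hT [s0 Ss0] cL.
pose L l := [set t | S t /\ h t <= l].
pose F := filter_from [set s | S s] (fun s => L (h s)).
have FF : ProperFilter F.
  apply: filter_from_proper; last by move=> s Ss; exists s.
  apply: filter_from_filter; first by exists s0.
  move=> s t Ss St; have [st|ts] := leP (h s) (h t).
    by exists s => // r [Sr rs]; split; split=> //; exact: le_trans st.
  by exists t => // r [Sr rt]; split; split=> //; rewrite (le_trans rt)// ltW.
have [|t [[St _] clt]] := cL (h s0) F _; first by exists s0.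
exists t => // s Ss.
suff [] : L (h s) t by [].
apply: (compact_closed hT (cL (h s))) => Q tQ.
by apply: clt => //; exists s.
Qed.

(** * The worst loss: attainment and continuity *)

Section minimax.
Context (R : realType) (X A B : metricType R).
Context (PhiA : X -> set A) (PhiB : X * A -> set B) (f : X * A * B -> R).
Hypothesis domA : mdom PhiA = [set: X].
Hypothesis domB : mdom PhiB = mgraph PhiA.
Hypothesis lscA : lower_semicont PhiA.
Hypothesis AlscB : A_lower_semicont PhiA PhiB.
Hypothesis supf : K_sup_compact PhiB (fun q : X * A * B => (f q)%:E).
Hypothesis inff : K_inf_compact (swap_map PhiA PhiB)
  (fun q : X * B * A => (swap_fun f q)%:E).

(** Meaningful on the graph of [PhiA] only: elsewhere the supremum is over the empty set, and [fine]
    turns its value into 0. *)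
Let F p := fine (worst_loss PhiB f p).
Let hX : hausdorff_space X := @metric_hausdorff R X.
Let hA : hausdorff_space A := @metric_hausdorff R A.
Let hB : hausdorff_space B := @metric_hausdorff R B.

Lemma worst_loss_attained p : mgraph PhiA p -> exists b,
  [/\ PhiB p b, worst_loss PhiB f p = (f (p, b))%:E &
      forall b', PhiB p b' -> f (p, b') <= f (p, b)].
Proof.
rewrite -domB => Pp.
have [b Pb bmax] := ex_minimum hB Pp (K_inf_slice supf p).
have {}bmax b' : PhiB p b' -> f (p, b') <= f (p, b).
  by move=> /bmax; rewrite lerN2.
exists b; split=> //; apply/le_anti/andP; split.
  by apply: ge_ereal_sup => _ [b' /bmax + <-]; rewrite lee_fin.
by apply: ereal_sup_ubound; exists b.
Qed.

Lemma worst_lossE p : mgraph PhiA p -> worst_loss PhiB f p = (F p)%:E.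
Proof. by move=> /worst_loss_attained[b [_ Fb _]]; rewrite /F Fb. Qed.

Lemma le_worst_loss p b : mgraph PhiA p -> PhiB p b -> f (p, b) <= F p.
Proof. by rewrite /F => /worst_loss_attained[c [_ -> cmax]] /cmax. Qed.

Lemma worst_loss_usc_seq (p_ : nat -> X * A) p (l : R) :
  (forall n, mgraph PhiA (p_ n)) -> mgraph PhiA p -> p_ @ \oo --> p ->
  (forall n, l <= F (p_ n)) -> l <= F p.
Proof.
move=> Pp_ Pp pp lF.
(* Maximizers along the sequence cluster, by K-sup-compactness, at a point of [PhiB p] where [f] is
   at least [l]. *)
have /choice[b_ b_P] : forall n, exists b,
    PhiB (p_ n) b /\ F (p_ n) = f (p_ n, b).
  move=> n; have [b [Pb Fb _]] := worst_loss_attained (Pp_ n).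
  by exists b; rewrite /F Fb.
have [||||b [Pb fb _]] := K_inf_seq (u := p_) (u0 := p) (y := b_)
  (l_ := fun=> - l) (l := - l) (hausdorff_prod hX hA) hB supf pp.
- by rewrite domB.
- by move=> n; have [] := b_P n.
- exact: cvg_cst.
- by move=> n; rewrite lerN2 -(b_P n).2.
- by move: fb; rewrite lerN2 => /le_trans; apply; exact: le_worst_loss.
Qed.

(** Along a subsequence, A-lower semi-continuity gives [b_] converging to [b0]. There [f] is bounded
    by the worst loss, hence by [l_], so K-inf-compactness of the swapped function makes the [a_]
    cluster. *)
Lemma A_lsc_cluster (x_ : nat -> X) x (a_ : nat -> A) a0 b0 (l_ : nat -> R) l :
  x_ @ \oo --> x -> (forall n, PhiA (x_ n) (a_ n)) -> PhiA x a0 ->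
  PhiB (x, a0) b0 -> l_ @ \oo --> l -> (forall n, F (x_ n, a_ n) <= l_ n) ->
  exists a, [/\ PhiA x a, PhiB (x, a) b0, f (x, a, b0) <= l &
    cluster ((fun n => (x_ n, a_ n)) @ \oo) (x, a)].
Proof.
move=> xx Pa_ Pa0 Pb0 ll Fl.
have [|b_ Pb_ [phi /cvg_subseq_index phioo bb]] :=
  AlscB (x_ := x_) (x := x) (a_ := a_) (b := b0) xx Pa_; first by exists a0.
have xbb : (fun n => (x_ (phi n), b_ (phi n))) @ \oo --> (x, b0).
  by apply: cvg_pair => //; exact: cvg_comp phioo xx.
have [||||a [[Pa Pb] fa cl]] := K_inf_seq (y := a_ \o phi)
  (l_ := l_ \o phi) (l := l) (hausdorff_prod hX hB) hA inff xbb.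
- by exists a0.
- by move=> n; split; [exact: Pa_|exact: Pb_].
- exact: cvg_comp phioo ll.
- move=> n; apply: le_trans (Fl (phi n)).
  by apply: le_worst_loss; [exact: Pa_|exact: Pb_].
(* A cluster point of the subsequence of triples is carried over to the full sequence of pairs by
   leaving the [B] coordinate free. *)
exists a; split => // P Q FP [[Q1 Q2] /= [xQ aQ] QQ].
have [||[[x1 b1] a1] [/= Pxa [[Qx _] Qa]]] := cl
  [set q | P (q.1.1, q.2)] ((Q1 `*` setT) `*` Q2).
- exact: (phioo _ FP).
- exists (Q1 `*` setT, Q2) => //=; split => //.
  by exists (Q1, setT) => //=; split => //; exact: filterT.
- by exists (x1, a1); split => //; apply: QQ.
Qed.

Lemma worst_loss_lsc_seq (p_ : nat -> X * A) p (l : R) :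
  (forall n, mgraph PhiA (p_ n)) -> mgraph PhiA p -> p_ @ \oo --> p ->
  (forall n, F (p_ n) <= l) -> F p <= l.
Proof.
case: p => x a Pp_ Pa pp Fl.
have [b [Pb Fb _]] := worst_loss_attained Pa.
have pE : (fun n => ((p_ n).1, (p_ n).2)) = p_.
  by apply/funext => n; case: (p_ n).
have {}Fl n : F ((p_ n).1, (p_ n).2) <= l by rewrite -surjective_pairing.
have p1 : fst \o p_ @ \oo --> x.
  exact: cvg_comp pp (cvg_fst (F := nbhs x) (G := nbhs a)).
(* With [b] a maximizer at the limit, a bound on [f] at [b] is a bound on [F]; convergence of [p_]
   forces the cluster point [a'] to be [a]. *)
have [a' [_ _ + ]] := A_lsc_cluster (a_ := snd \o p_) p1 Pp_ Pa Pb
  (cvg_cst l) Fl.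
rewrite /= pE => fl /(cvg_cluster_unique (hausdorff_prod hX hA) pp)[aa'].
by rewrite /F Fb/= aa'.
Qed.

Lemma worst_loss_near_lt p c : mgraph PhiA p -> F p < c ->
  \forall q \near within (mgraph PhiA) (nbhs p), F q < c.
Proof.
move=> Pp Fc; apply: near_within_seq => u Du up; apply: contrapT => /forallNP nF.
suff : c <= F p by rewrite leNgt Fc.
by apply: worst_loss_usc_seq Du Pp up _ => n; rewrite leNgt; apply/negP.
Qed.

Lemma worst_loss_near_gt p c : mgraph PhiA p -> c < F p ->
  \forall q \near within (mgraph PhiA) (nbhs p), c < F q.
Proof.
move=> Pp Fc; apply: near_within_seq => u Du up; apply: contrapT => /forallNP nF.
suff : F p <= c by rewrite leNgt Fc.
by apply: worst_loss_lsc_seq Du Pp up _ => n; rewrite leNgt; apply/negP.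
Qed.

Lemma worst_loss_cvg p : mgraph PhiA p ->
  F @ within (mgraph PhiA) (nbhs p) --> F p.
Proof.
move=> Pp; apply/cvgrPdist_lt => e e0; near=> q.
rewrite ltr_distlC; apply/andP; split; near: q.
- by apply: worst_loss_near_gt => //; rewrite ltrBlDr ltrDl.
- by apply: worst_loss_near_lt => //; rewrite ltrDl.
Unshelve. all: by end_near. Qed.

(* A_lower_semicont does not ask [a_] to converge, so a constant sequence in
   x already forces PhiB (x, a) not to depend on a in PhiA x. *)
Lemma PhiB_indep x a a' : PhiA x a -> PhiA x a' -> PhiB (x, a) `<=` PhiB (x, a').
Proof.
move=> Pa Pa' b Pb.
have [a1 [_ Pb1 _ cl]] := A_lsc_cluster (cvg_cst x) (fun=> Pa') Pa Pb
  (cvg_cst (F (x, a'))) (fun=> lexx _).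
have xa' : (fun _ : nat => (x, a')) @ \oo --> (x, a') by exact: cvg_cst.
by have [->] := cvg_cluster_unique (hausdorff_prod hX hA) xa' cl.
Qed.

(** * The minimax function: attainment and continuity *)

Lemma worst_loss_slice_compact x l : compact [set a | PhiA x a /\ F (x, a) <= l].
Proof.
have [a0 Pa0] : mdom PhiA x by rewrite domA.
have [b0 [Pb0 _ _]] := worst_loss_attained (p := (x, a0)) Pa0.
pose K b := [set a | swap_map PhiA PhiB (x, b) a /\ swap_fun f (x, b, a) <= l].
have cK b : compact (K b) by apply: K_inf_slice inff _ _.
(* A supremum is at most [l] iff each term is; by [PhiB_indep] the index set [PhiB (x, a0)] serves
   every [a] at once. *)
have -> : [set a | PhiA x a /\ F (x, a) <= l] = \bigcap_(b in PhiB (x, a0)) K b.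
  apply/seteqP; split=> [a [Pa Fa] b Pb|a Ka].
    split; first by split=> //; exact: PhiB_indep Pb.
    by apply: le_trans Fa; apply: le_worst_loss => //; exact: PhiB_indep Pb.
  have [[Pa _] _] := Ka _ Pb0; split=> //.
  have [b [Pb Fb _]] := worst_loss_attained (p := (x, a)) Pa.
  have [|_ ] := Ka b; first exact: PhiB_indep Pb.
  by rewrite /F Fb.
apply: subclosed_compact (cK b0) _; last by move=> a; apply.
by apply: closed_bigI => b _; exact: compact_closed.
Qed.

Lemma minimax_attained x : exists a,
  [/\ PhiA x a, minimax PhiA PhiB f x = (F (x, a))%:E &
      forall a', PhiA x a' -> F (x, a) <= F (x, a')].
Proof.
have PAx : PhiA x !=set0 by rewrite -[_ !=set0]/(mdom PhiA x) domA.
have [a Pa amin] := ex_minimum hA PAx (@worst_loss_slice_compact x).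
exists a; split=> //; apply/le_anti/andP; split.
  by apply: ereal_inf_lbound; exists a => //; rewrite worst_lossE.
by apply: le_ereal_inf_tmp => _ [a' Pa' <-]; rewrite worst_lossE// lee_fin amin.
Qed.

Let v x := fine (minimax PhiA PhiB f x).

Lemma minimaxE x : minimax PhiA PhiB f x = (v x)%:E.
Proof. by rewrite /v; have [a [_ -> _]] := minimax_attained x. Qed.

Lemma minimax_le x a : PhiA x a -> v x <= F (x, a).
Proof.
by move=> Pa; rewrite /v; have [a' [_ ->]] := minimax_attained x; apply.
Qed.

(** Written with an inequality, the solution set becomes a sublevel set, to which the compactness
    results apply. *)
Lemma solAE x : solA PhiA PhiB f x = [set a | PhiA x a /\ F (x, a) <= v x].
Proof.
apply/seteqP; split=> a [Pa].
  by rewrite minimaxE worst_lossE// => -[->].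
move=> Fv; split=> //; rewrite minimaxE worst_lossE//; congr _%:E.
by apply/le_anti/andP; split=> //; exact: minimax_le.
Qed.

Lemma solBE p : mgraph PhiA p ->
  solB PhiB f p = [set b | PhiB p b /\ F p <= f (p, b)].
Proof.
move=> Pp; apply/seteqP; split=> b [Pb].
  by rewrite worst_lossE// => -[->].
move=> Fv; split=> //; rewrite worst_lossE//; congr _%:E.
by apply/le_anti/andP; split=> //; exact: le_worst_loss.
Qed.

Lemma worst_loss_cluster (x_ : nat -> X) x (a_ : nat -> A) (l_ : nat -> R) l :
  x_ @ \oo --> x -> (forall n, PhiA (x_ n) (a_ n)) ->
  l_ @ \oo --> l -> (forall n, F (x_ n, a_ n) <= l_ n) ->
  exists a, [/\ PhiA x a, F (x, a) <= l & cluster (a_ @ \oo) a].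
Proof.
move=> xx Pa_ ll Fl.
have [a0 Pa0] : mdom PhiA x by rewrite domA.
have [b0 [Pb0 _ _]] := worst_loss_attained (p := (x, a0)) Pa0.
have [a [Pa _ _ cl]] := A_lsc_cluster xx Pa_ Pa0 Pb0 ll Fl.
exists a; split=> //; last first.
  move=> P Q FP aQ.
  have [||[x1 a1] [/= P1 Q1]] := cl (snd @^-1` P) (snd @^-1` Q); last by exists a1.
  - exact: FP.
  - exact: (cvg_snd (F := nbhs x) (G := nbhs a)).
(* [A_lsc_cluster] bounds [f] at [b0] only; the bound on [F] comes from its lower semi-continuity. A
   midpoint [m] would separate [l_ n], eventually below it, from [F] near the cluster point. *)
rewrite leNgt; apply/negP => lF.
have [m1 m2] := midf_lt lF.
set m := (l + _) / 2%:R in m1 m2.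
have [||_ [[n [Pn lm] <-] /= /(_ Pn)]] := cl
  [set (x_ n, a_ n) | n in [set n | mgraph PhiA (x_ n, a_ n) /\ l_ n < m]]
  [set q | mgraph PhiA q -> m < F q].
- have : \forall n \near \oo, l_ n < m by apply: cvgr_lt ll _ m1.
  by apply: filterS => n lm /=; exists n => //; split=> //; exact: Pa_.
- exact: worst_loss_near_gt.
by rewrite ltNge (le_trans (Fl n))// ltW.
Qed.

Lemma minimax_near_lt x c : v x < c -> \forall y \near x, v y < c.
Proof.
have [a [Pa vE _]] := minimax_attained x; rewrite {1}/v vE /= => Fc.
have [[W1 W2] /= [xW1 aW2] W] := worst_loss_near_lt (p := (x, a)) Pa Fc.
(* Lower semi-continuity of [PhiA] gives nearby [y] an action close to the minimizer [a], where the
   worst loss is still below [c]. *)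
have lscx : \forall y \near x, PhiA y `&` W2° !=set0.
  have domx : mdom PhiA x by rewrite domA.
  have := lscA domx (open_interior W2) (ex_intro _ a (conj Pa aW2)).
  by rewrite domA near_withinE; apply: filterS => y; exact.
near=> y.
have [a' [Pa' /nbhs_singleton W2a']] : PhiA y `&` W2° !=set0 by near: y.
apply: le_lt_trans (minimax_le Pa') _.
by apply: W => //; split=> //=; near: y.
Unshelve. all: by end_near. Qed.

Lemma minimax_near_gt x c : c < v x -> \forall y \near x, c < v y.
Proof.
move=> cv; have : \forall y \near within setT (nbhs x), c < v y.
  apply: near_within_seq => u _ ux; apply: contrapT => /forallNP nv.
  (* Minimizers at points where [v] is at most [c] cluster at an action witnessing [v x <= c]. *)
  have /choice[a_ a_P] : forall n, exists a, PhiA (u n) a /\ F (u n, a) <= c.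
    move=> n; have [a [Pa vE _]] := minimax_attained (u n); exists a; split=> //.
    by have /negP := nv n; rewrite /v vE -leNgt.
  have [a [Pa Fa _]] := worst_loss_cluster ux (fun n => (a_P n).1)
    (cvg_cst c) (fun n => (a_P n).2).
  by have := le_lt_trans (le_trans (minimax_le Pa) Fa) cv; rewrite ltxx.
by rewrite near_withinE; apply: filterS => y; exact.
Qed.

Lemma minimax_continuous : continuous v.
Proof.
move=> x; apply/cvgrPdist_lt => e e0; near=> y.
rewrite ltr_distlC; apply/andP; split; near: y.
- by apply: minimax_near_gt; rewrite ltrBlDr ltrDl.
- by apply: minimax_near_lt; rewrite ltrDl.
Unshelve. all: by end_near. Qed.

(** * The solution multifunctions *)

Lemma solA_usc : upper_semicont (solA PhiA PhiB f).
Proof.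
move=> x _ G oG solG; apply: near_within_seq => u _ ux.
apply: contrapT => /forallNP nG.
have /choice[a_ a_P] : forall n, exists a,
    [/\ PhiA (u n) a, F (u n, a) <= v (u n) & ~ G a].
  move=> n; have /existsNP[a /not_implyP[+ nGa]] := nG n.
  by rewrite solAE => -[Pa Fa]; exists a.
(* Solutions outside [G] cluster at a solution for [x], since the bounds [v (u n)] tend to [v x];
   that point lies in the open set [G], a contradiction. *)
have [|||a [Pa Fa cl]] := worst_loss_cluster (a_ := a_) (l_ := v \o u)
  (l := v x) ux.
- by move=> n; have [] := a_P n.
- by apply: (cvg_comp _ _ ux); exact: minimax_continuous.
- by move=> n; have [] := a_P n.
have Ga : G a by apply: solG; rewrite solAE.
have [||_ [[n _ <-]]] := cl (range a_) G; last by have [] := a_P n.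
- by exists 0%N => // n _; exists n.
- exact: open_nbhs_nbhs.
Qed.

Lemma solA_compact x : compact (solA PhiA PhiB f x).
Proof. rewrite solAE; exact: worst_loss_slice_compact. Qed.

Lemma mdom_solA : mdom (solA PhiA PhiB f) = [set: X].
Proof.
apply/seteqP; split=> // x _; have [a [Pa vE _]] := minimax_attained x.
by exists a; rewrite solAE; split=> //; rewrite /v vE.
Qed.

Lemma mdom_solB : mdom (solB PhiB f) = mgraph PhiA.
Proof.
apply/seteqP; split=> [p [b [Pb _]]|p Pp]; first by rewrite -domB; exists b.
by have [b [Pb Fb _]] := worst_loss_attained Pp; exists b.
Qed.

Lemma solB_compact p : mgraph PhiA p -> compact (solB PhiB f p).
Proof.
move=> Pp; rewrite solBE//.
have := K_inf_slice supf p (- F p).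
by under eq_set do rewrite lerN2.
Qed.

Lemma solB_usc : upper_semicont (solB PhiB f).
Proof.
move=> p; rewrite mdom_solB => Pp G oG solG; apply: near_within_seq => u Du up.
apply: contrapT => /forallNP nG.
have /choice[b_ b_P] : forall n, exists b,
    [/\ PhiB (u n) b, F (u n) <= f (u n, b) & ~ G b].
  move=> n; have /existsNP[b /not_implyP[+ nGb]] := nG n.
  by rewrite solBE// => -[Pb Fb]; exists b.
have [||||b [Pb Fb cl]] := K_inf_seq (u := u) (u0 := p) (y := b_)
  (l_ := fun n => - F (u n)) (l := - F p) (hausdorff_prod hX hA) hB supf up.
- by rewrite domB.
- by move=> n; have [] := b_P n.
(* Continuity of [F] is relative to the graph, in which the sequence [u] stays. *)
- apply: cvgN; apply: cvg_comp (worst_loss_cvg Pp) => P.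
  by case/up => N _ NP; exists N => // n /NP; apply; exact: Du.
- by move=> n; rewrite lerN2; have [] := b_P n.
have Gb : G b by apply: solG; rewrite solBE//; rewrite lerN2 in Fb.
have [||_ [[n _ <-]]] := cl (range (fun n => (u n, b_ n))) (snd @^-1` G).
- by exists 0%N => // n _; exists n.
- apply: (cvg_snd (F := nbhs p) (G := nbhs b)); exact: open_nbhs_nbhs.
- by have [] := b_P n.
Qed.

Lemma is_max_worst_loss p : mgraph PhiA p ->
  is_max [set (f (p, b))%:E | b in PhiB p] (worst_loss PhiB f p).
Proof.
move=> Pp; have [b [Pb Fb _]] := worst_loss_attained Pp.
by split; [exists b|exact: ereal_sup_ubound].
Qed.

(** A maximum of a set equals its supremum, so both infima run over the same set of values. *)
Lemma minimax_inf_max x : minimax PhiA PhiB f x =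
  ereal_inf [set m | exists2 a, PhiA x a &
    is_max [set (f (x, a, b))%:E | b in PhiB (x, a)] m].
Proof.
congr ereal_inf; apply/seteqP; split=> [_ [a Pa <-]|m [a Pa [Sm Um]]].
  by exists a => //; exact: (@is_max_worst_loss (x, a)).
exists a => //; apply/le_anti/andP; split; first exact: ge_ereal_sup.
exact: ereal_sup_ubound.
Qed.

End minimax.

Theorem theorem13 (R : realType) (X A B : metricType R)
    (PhiA : X -> set A) (PhiB : X * A -> set B) (f : X * A * B -> R)
    (domA : mdom PhiA = [set: X])
    (domB : mdom PhiB = mgraph PhiA)
    (lscA : lower_semicont PhiA)
    (AlscB : A_lower_semicont PhiA PhiB)
    (supf : K_sup_compact PhiB (fun q : X * A * B => (f q)%:E))
    (inff : K_inf_compact (swap_map PhiA PhiB)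
              (fun q : X * B * A => (swap_fun f q)%:E)) :
  [/\ (forall p, mgraph PhiA p -> worst_loss PhiB f p \is a fin_num) /\
      {within mgraph PhiA, continuous (fun p => fine (worst_loss PhiB f p))},
      (forall x, minimax PhiA PhiB f x \is a fin_num) /\
      continuous (fun x => fine (minimax PhiA PhiB f x)),
      [/\ forall x, is_min [set worst_loss PhiB f (x, a) | a in PhiA x]
                           (minimax PhiA PhiB f x),
          mdom (solA PhiA PhiB f) = [set: X],
          upper_semicont (solA PhiA PhiB f) &
          forall x, compact (solA PhiA PhiB f x)] &
      [/\ forall p, mgraph PhiA p ->
            is_max [set (f (p, b))%:E | b in PhiB p] (worst_loss PhiB f p),
          forall x, minimax PhiA PhiB f x =
            ereal_inf [set m | exists2 a, PhiA x a &
                         is_max [set (f (x, a, b))%:E | b in PhiB (x, a)] m],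
          mdom (solB PhiB f) = mgraph PhiA,
          upper_semicont (solB PhiB f) &
          forall p, mgraph PhiA p -> compact (solB PhiB f p)]].
split.
- split=> [p Pp|]; first by rewrite (worst_lossE domB supf Pp).
  by apply/subspace_continuousP => p; exact: worst_loss_cvg.
- split=> [x|]; first by rewrite (minimaxE domA domB AlscB supf inff).
  exact: minimax_continuous.
- split.
  + move=> x; split; last by move=> m; exact: ereal_inf_lbound.
    have [a [Pa -> _]] := minimax_attained domA domB AlscB supf inff x.
    by exists a => //; exact: (worst_lossE domB supf).
  + exact: mdom_solA.
  + exact: solA_usc.
  + by move=> ?; apply: solA_compact.
- split.
  + exact: is_max_worst_loss.
  + exact: minimax_inf_max.
  + exact: mdom_solB.
  + by apply: solB_usc domB AlscB supf inff.
  + by move=> ?; apply: solB_compact.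
Qed.
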